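(* For a nonnegative data matrix $M=(m_1,\dots,m_n)\in\mathbb{R}^{m\times n}_+$, the orthogonal nonnegative matrix factorization (ONMF) problem $$\min_{U\ge 0,\ V\ge 0}\ \|M-UV\|_F^2\quad\text{such that}\quad VV^T=I_k$$ is equivalent to the following weighted variant of spherical $k$-means $$\max_{\{\pi_i,\ u_i\in\mathbb{R}^m_+,\ \|u_i\|_2=1\}_{i=1}^k}\ \sum_{i=1}^k\sum_{j\in\pi_i}\|m_j\|^2\left(\frac{m_j^T}{\|m_j\|}u_i\right)^2,$$ where $\{\pi_i\}_{i=1}^k$ is a set of disjoint clusters.
   Context: $m_1,\dots,m_n\in\mathbb{R}^m_+$ are the columns of $M$, and $k$ is a given factorization rank with $k<n$. In the ONMF problem the variables are $U\in\mathbb{R}^{m\times k}$ and $V\in\mathbb{R}^{k\times n}$; $U\ge 0$ and $V\ge 0$ mean entrywise nonnegativity, $\|\cdot\|_F$ is the Frobenius norm, and $I_k$ is the $k\times k$ identity matrix. $\mathbb{R}^m_+$ and $\mathbb{R}^{m\times n}_+$ denote the vectors and matrices with nonnegative entries, and $\|\cdot\|=\|\cdot\|_2$ is the Euclidean norm. A set $\{\pi_i\}_{i=1}^k$ of $k$ disjoint clusters is a family of subsets $\pi_i\subseteq\{1,\dots,n\}$ with $\bigcup_{1\le i\le k}\pi_i=\{1,\dots,n\}$ and $\pi_i\cap\pi_j=\emptyset$ for all $i\ne j$. That the two problems are equivalent means that a solution of the first is obtained from a solution of the second by means of elementary arithmetic operations, and vice versa. *)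

(* Defs.v *)
From mathcomp Require Import all_boot all_order all_algebra reals.

Set Implicit Arguments.
Unset Strict Implicit.
Unset Printing Implicit Defensive.

Import Order.TTheory GRing.Theory Num.Theory.
Local Open Scope ring_scope.

Section Norms.
Variable R : realType.

Definition nonneg_mx (p q : nat) (A : 'M[R]_(p, q)) : Prop :=
  forall i j, 0 <= A i j.

(* The norm that MathComp-Analysis puts on matrices is the sup norm, hence
   these two definitions. *)
Definition enorm (p : nat) (x : 'cV[R]_p) : R :=
  Num.sqrt (\sum_(i < p) x i 0 ^+ 2).

Definition fnorm (p q : nat) (A : 'M[R]_(p, q)) : R :=
  Num.sqrt (\sum_(i < p) \sum_(j < q) A i j ^+ 2).

End Norms.

Section Optimization.
Variables (R : realType) (T : Type) (feasible : T -> Prop) (f : T -> R).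

Definition minimizer (x : T) : Prop :=
  feasible x /\ forall y, feasible y -> f x <= f y.

Definition maximizer (x : T) : Prop :=
  feasible x /\ forall y, feasible y -> f y <= f x.

End Optimization.

Section Problems.
Variables (R : realType) (m n k : nat).

Definition onmf_point : Type := ('M[R]_(m, k) * 'M[R]_(k, n))%type.

Definition onmf_feasible (x : onmf_point) : Prop :=
  let: (U, V) := x in
  [/\ nonneg_mx U, nonneg_mx V & V *m V^T = 1%:M].

Definition onmf_objective (M : 'M[R]_(m, n)) (x : onmf_point) : R :=
  let: (U, V) := x in fnorm (M - U *m V) ^+ 2.

Definition onmf_solution (M : 'M[R]_(m, n)) : onmf_point -> Prop :=
  minimizer onmf_feasible (onmf_objective M).

(* Clusters may be empty. *)
Definition disjoint_clusters (pi : 'I_k -> {set 'I_n}) : Prop :=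
  \bigcup_(i < k) pi i = [set: 'I_n] /\
  forall i j, i != j -> pi i :&: pi j = set0.

Definition kmeans_point : Type :=
  (('I_k -> {set 'I_n}) * ('I_k -> 'cV[R]_m))%type.

Definition kmeans_feasible (y : kmeans_point) : Prop :=
  let: (pi, u) := y in
  disjoint_clusters pi /\ forall i, nonneg_mx (u i) /\ enorm (u i) = 1.

(* When m_j = 0 the quotient m_j^T / ||m_j|| is 0 * 0^-1 = 0, so that column
   contributes 0. *)
Definition kmeans_objective (M : 'M[R]_(m, n)) (y : kmeans_point) : R :=
  let: (pi, u) := y in
  \sum_(i < k) \sum_(j in pi i)
    enorm (col j M) ^+ 2 *
    (((enorm (col j M))^-1 *: (col j M)^T *m u i) 0 0) ^+ 2.

Definition kmeans_solution (M : 'M[R]_(m, n)) : kmeans_point -> Prop :=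
  maximizer kmeans_feasible (kmeans_objective M).

End Problems.

(* The real functions on X that can be computed from the quantities c i x by
   finitely many elementary arithmetic operations. The square root is what
   normalizing a vector requires, and the comparison test is what reading off
   a cluster such as {j | V i j > 0} requires. Only rational constants are
   allowed, so a formula cannot hard-code a solution. The conventions 0^-1 = 0
   and sqrt a = 0 for a < 0 add nothing, given the test. *)
Inductive arith (R : realType) (X I : Type) (c : I -> X -> R) :
    (X -> R) -> Prop :=
| arith_input i : arith c (c i)
| arith_const (q : rat) : arith c (fun _ => ratr q)
| arith_add f g : arith c f -> arith c g -> arith c (fun x => f x + g x)
| arith_opp f : arith c f -> arith c (fun x => - f x)
| arith_mul f g : arith c f -> arith c g -> arith c (fun x => f x * g x)
| arith_inv f : arith c f -> arith c (fun x => (f x)^-1)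
| arith_sqrt f : arith c f -> arith c (fun x => Num.sqrt (f x))
| arith_test a b f g : arith c a -> arith c b -> arith c f -> arith c g ->
    arith c (fun x => if a x <= b x then f x else g x).

Definition arith_map (R : realType) (X I Y J : Type)
    (c : I -> X -> R) (d : J -> Y -> R) (phi : X -> Y) : Prop :=
  forall j, arith c (fun x => d j (phi x)).

Section Coordinates.
Variables (R : realType) (m n k : nat).

Definition onmf_coord (s : ('I_m * 'I_k) + ('I_k * 'I_n))
    (x : onmf_point R m n k) : R :=
  match s with
  | inl (a, i) => x.1 a i
  | inr (i, j) => x.2 i j
  end.

(* A cluster is presented by its 0/1 indicator vector. *)
Definition kmeans_coord (s : ('I_k * 'I_n) + ('I_k * 'I_m))
    (y : kmeans_point R m n k) : R :=
  match s with
  | inl (i, j) => (j \in y.1 i)%:R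
  | inr (i, a) => y.2 i a 0
  end.

Definition with_data (T J : Type) (c : J -> T -> R)
    (s : ('I_m * 'I_n) + J) (x : 'M[R]_(m, n) * T) : R :=
  match s with
  | inl (a, j) => x.1 a j
  | inr t => c t x.2
  end.

End Coordinates.

(* Main.v *)
Require Import Defs.
From mathcomp Require Import all_boot all_order all_algebra reals.
From mathcomp Require Import boolp ring lra.

(** Write [v_i] for the rows of [V] and [f], [F] for the objectives of the
    factorization and of the clustering problem. If [V V^T = I], the
    Pythagorean identity [onmf_residual] reads
    [||M - U V||^2 = ||M||^2 - ||M V^T||^2 + ||U - M V^T||^2], so the best [U]
    is [M V^T], which is nonnegative, and the factorization problem maximizes
    [||M V^T||^2 = \sum_i ||M v_i||^2]. Nonnegativity and orthogonality force
    the [v_i] to have disjoint supports, and on a given support [pi_i] the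
    maximum of [||M v||^2] over unit [v] and that of
    [\sum_(j in pi_i) (m_j^T u)^2] over unit [u] both are the largest squared
    singular value of the block of columns [m_j], [j] in [pi_i]. The two
    are compared directly: normalizing [M v] turns [v] into a [u] that is at least
    as good, normalizing the vector of inner products [m_j^T u] turns [u] into
    such a [v], and both claims are the Cauchy-Schwarz inequality against a
    unit vector.

    This gives maps [phi], [psi] between the feasible sets with
    [||M||^2 - f x <= F (phi x)] ([onmf_to_kmeansP]) and
    [F y <= ||M||^2 - f (psi y)] ([kmeans_to_onmfP]). Two such maps send
    solutions to solutions, because no feasible [y] beats [phi x] without
    [psi y] beating [x], and symmetrically.

    The delicate point is that clusters may be empty, whereas no row of [V]
    vanishes. Since [k <= n], columns can be moved one at a time into the empty
    clusters ([surjective_reassignment]); a column alone in its cluster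
    contributes [||m_j||^2], the most it can, so nothing is lost. The
    reassignment is chosen non-effectively, but it depends only on the clusters,
    which range over a finite type, and a finite case distinction on computable
    indicators is again an arithmetic formula ([arith_case]). *)

Set Implicit Arguments.
Unset Strict Implicit.
Unset Printing Implicit Defensive.

Import Order.TTheory GRing.Theory Num.Theory.
Local Open Scope ring_scope.

(** * Unit vectors *)

Lemma sum_sqr_ge0 (R : realType) (I : finType) (x : I -> R) :
  0 <= \sum_i x i ^+ 2.
Proof. by apply: sumr_ge0 => i _; apply: sqr_ge0. Qed.

Lemma sum_sqr_eq0 (R : realType) (I : finType) (x : I -> R) :
  \sum_i x i ^+ 2 <= 0 -> forall i, x i = 0.
Proof.
move=> x_le0 i; apply/eqP; rewrite -sqrf_eq0 eq_le sqr_ge0 andbT.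
apply: le_trans x_le0; rewrite (bigD1 i) //= lerDl.
by apply: sumr_ge0 => j _; apply: sqr_ge0.
Qed.

(** The Cauchy-Schwarz inequality against a unit vector [e]: the residual
    [x - t e], where [t] is the inner product, has a nonnegative square. *)
Lemma sqr_dot_unit_le (R : realType) (I : finType) (x e : I -> R) :
  \sum_i e i ^+ 2 = 1 -> (\sum_i x i * e i) ^+ 2 <= \sum_i x i ^+ 2.
Proof.
move=> e1; have := sum_sqr_ge0 (fun i => x i - (\sum_i x i * e i) * e i).
have -> (t : R) : \sum_i (x i - t * e i) ^+ 2 = \sum_i x i ^+ 2
    - 2 * t * (\sum_i x i * e i) + t ^+ 2 * \sum_i e i ^+ 2.
  rewrite !mulr_sumr -sumrB -big_split /=.
  by apply: eq_bigr => i _; ring.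
by rewrite e1; lra.
Qed.

(** The fallback direction [d] makes normalization total, so that a feasible
    point is produced even from a vanishing vector. *)
Definition normalize (R : realType) (I : finType) (d x : I -> R) (i : I) : R :=
  if \sum_j x j ^+ 2 <= 0 then d i / Num.sqrt (\sum_j d j ^+ 2)
  else x i / Num.sqrt (\sum_j x j ^+ 2).

Lemma normalize_ge0 (R : realType) (I : finType) (d x : I -> R) :
  (forall i, 0 <= d i) -> (forall i, 0 <= x i) ->
  forall i, 0 <= normalize d x i.
Proof.
move=> d_ge0 x_ge0 i; rewrite /normalize.
by case: ifP => _; rewrite mulr_ge0 // invr_ge0 sqrtr_ge0.
Qed.

Lemma normalize_eq0 (R : realType) (I : finType) (d x : I -> R) i :
  d i = 0 -> x i = 0 -> normalize d x i = 0.
Proof. by rewrite /normalize => -> ->; rewrite !mul0r if_same. Qed.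

Lemma normalize_unit (R : realType) (I : finType) (d x : I -> R) i0 :
  d i0 != 0 -> \sum_i normalize d x i ^+ 2 = 1.
Proof.
move=> d0.
have unit_sum (y : I -> R) : 0 < \sum_i y i ^+ 2 ->
    \sum_i (y i / Num.sqrt (\sum_j y j ^+ 2)) ^+ 2 = 1.
  move=> y_gt0; under eq_bigr do rewrite expr_div_n sqr_sqrtr ?sum_sqr_ge0 //.
  by rewrite -mulr_suml mulfV // gt_eqF.
rewrite /normalize; case: leP => [_|/unit_sum //]; apply: unit_sum.
by rewrite ltNge; apply: contra d0 => /sum_sqr_eq0 ->.
Qed.

Lemma sqr_dot_normalize (R : realType) (I : finType) (d x : I -> R) :
  (\sum_i x i * normalize d x i) ^+ 2 = \sum_i x i ^+ 2.
Proof.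
rewrite /normalize; case: leP => [/sum_sqr_eq0 x0|x_gt0].
  rewrite big1 => [|i _]; last by rewrite x0 mul0r.
  by rewrite expr0n big1 // => i _; rewrite x0 expr0n.
under eq_bigr do rewrite mulrA -expr2.
rewrite -mulr_suml expr_div_n sqr_sqrtr ?sum_sqr_ge0 // expr2 mulfK //.
by rewrite gt_eqF.
Qed.

(** * Arithmetic formulas *)

Lemma arith_ext (R : realType) (X I : Type) (c : I -> X -> R) (f g : X -> R) :
  f =1 g -> arith c f -> arith c g.
Proof. by move=> /funext ->. Qed.

Lemma arith_nat (R : realType) (X I : Type) (c : I -> X -> R) (p : nat) :
  arith c (fun _ => p%:R).
Proof. by apply: arith_ext (arith_const c p%:R) => x; rewrite ratr_nat. Qed.

Lemma arith_sum (R : realType) (X I : Type) (c : I -> X -> R) (J : Type)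
    (r : seq J) (P : pred J) (f : J -> X -> R) :
  (forall j, arith c (f j)) -> arith c (fun x => \sum_(j <- r | P j) f j x).
Proof.
move=> cf; elim: r => [|j r IHr].
  by apply: arith_ext (arith_nat c 0) => x; rewrite big_nil.
case Pj: (P j); last by apply: arith_ext IHr => x; rewrite big_cons Pj.
by apply: arith_ext (arith_add (cf j) IHr) => x; rewrite big_cons Pj.
Qed.

Lemma arith_prod (R : realType) (X I : Type) (c : I -> X -> R) (J : Type)
    (r : seq J) (P : pred J) (f : J -> X -> R) :
  (forall j, arith c (f j)) -> arith c (fun x => \prod_(j <- r | P j) f j x).
Proof.
move=> cf; elim: r => [|j r IHr].
  by apply: arith_ext (arith_nat c 1) => x; rewrite big_nil.
case Pj: (P j); last by apply: arith_ext IHr => x; rewrite big_cons Pj.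
by apply: arith_ext (arith_mul (cf j) IHr) => x; rewrite big_cons Pj.
Qed.

Lemma arith_sqr (R : realType) (X I : Type) (c : I -> X -> R) (f : X -> R) :
  arith c f -> arith c (fun x => f x ^+ 2).
Proof. by move=> cf; apply: arith_mul. Qed.

Lemma arith_normalize (R : realType) (X I : Type) (c : I -> X -> R)
    (J : finType) (d x : J -> X -> R) :
  (forall j, arith c (d j)) -> (forall j, arith c (x j)) ->
  forall j, arith c (fun z => normalize (d^~ z) (x^~ z) j).
Proof.
move=> cd cx j.
have csum (y : J -> X -> R) : (forall j, arith c (y j)) ->
    arith c (fun z => \sum_l y l z ^+ 2).
  by move=> cy; apply: arith_sum => l; apply/arith_sqr/cy.
apply: arith_test; first exact: csum.
- exact: (arith_nat c 0).
- by apply: arith_mul => //; apply/arith_inv/arith_sqrt/csum.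
- by apply: arith_mul => //; apply/arith_inv/arith_sqrt/csum.
Qed.

(** A formula may depend arbitrarily on finite data [b x] whose indicators are
    computable, since [F (b x) x] is the sum of [(b x == t)%:R * F t x] over
    the values [t]. *)
Lemma arith_case (R : realType) (X I : Type) (c : I -> X -> R) (T : finType)
    (b : X -> T) (F : T -> X -> R) :
  (forall t, arith c (fun x => (b x == t)%:R)) -> (forall t, arith c (F t)) ->
  arith c (fun x => F (b x) x).
Proof.
move=> cb cF.
apply: (@arith_ext _ _ _ _ (fun x => \sum_t (b x == t)%:R * F t x)); last first.
  by apply: arith_sum => t; apply: arith_mul.
move=> x; rewrite (bigD1 (b x)) //= eqxx mul1r big1 ?addr0 // => t.
by rewrite eq_sym => /negPf ->; rewrite mul0r.
Qed.

(** * The objective functions *)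

Lemma fnorm_sqr (R : realType) (p q : nat) (A : 'M[R]_(p, q)) :
  fnorm A ^+ 2 = \sum_i \sum_j A i j ^+ 2.
Proof.
by rewrite sqr_sqrtr //; apply: sumr_ge0 => i _; apply: sum_sqr_ge0.
Qed.

Lemma enorm_sqr (R : realType) (p : nat) (x : 'cV[R]_p) :
  enorm x ^+ 2 = \sum_i x i 0 ^+ 2.
Proof. by rewrite sqr_sqrtr // sum_sqr_ge0. Qed.

Lemma fnorm_sqr_trace (R : realType) (p q : nat) (A : 'M[R]_(p, q)) :
  fnorm A ^+ 2 = \tr (A *m A^T).
Proof.
rewrite fnorm_sqr; apply: eq_bigr => i _; rewrite mxE.
by apply: eq_bigr => j _; rewrite mxE expr2.
Qed.

(** Since [V] has orthonormal rows, [M V^T V] is the orthogonal projection of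
    [M] on the matrices of the form [U V]; this is the Pythagorean identity. *)
Lemma onmf_residual (R : realType) (m n k : nat) (M : 'M[R]_(m, n))
    (U : 'M[R]_(m, k)) (V : 'M[R]_(k, n)) :
  V *m V^T = 1%:M ->
  fnorm (M - U *m V) ^+ 2 =
  fnorm M ^+ 2 - fnorm (M *m V^T) ^+ 2 + fnorm (U - M *m V^T) ^+ 2.
Proof.
move=> V1; rewrite !fnorm_sqr_trace.
rewrite !linearB /= !mulmxBl !trmx_mul !trmxK !linearB /=.
have -> : U *m V *m (V^T *m U^T) = U *m U^T.
  by rewrite mulmxA -(mulmxA U) V1 mulmx1.
by rewrite !mulmxA; ring.
Qed.

Definition coldot (R : realType) (m n : nat) (M : 'M[R]_(m, n)) (u : 'cV[R]_m)
    (j : 'I_n) : R :=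
  \sum_a M a j * u a 0.

Lemma coldot_ge0 (R : realType) (m n : nat) (M : 'M[R]_(m, n)) (u : 'cV[R]_m) :
  nonneg_mx M -> nonneg_mx u -> forall j, 0 <= coldot M u j.
Proof. by move=> M_ge0 u_ge0 j; apply: sumr_ge0 => a _; apply: mulr_ge0. Qed.

(** The weight [||m_j||^2] cancels the normalization of [m_j], also when
    [m_j = 0]. *)
Lemma kmeans_objectiveE (R : realType) (m n k : nat) (M : 'M[R]_(m, n))
    (pi : 'I_k -> {set 'I_n}) (u : 'I_k -> 'cV[R]_m) :
  kmeans_objective M (pi, u) =
  \sum_i \sum_(j in pi i) coldot M (u i) j ^+ 2.
Proof.
apply: eq_bigr => i _; apply: eq_bigr => j _.
rewrite -exprMn -scalemxAl mxE.
have -> : ((col j M)^T *m u i) 0 0 = coldot M (u i) j.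
  by rewrite mxE; apply: eq_bigr => a _; rewrite !mxE.
have [M0|M_neq0] := eqVneq (enorm (col j M)) 0; last by rewrite mulVKf.
rewrite M0 mul0r /coldot big1 // => a _.
have := @sum_sqr_eq0 _ _ (fun a => col j M a 0) _ a.
by rewrite -enorm_sqr M0 expr0n mxE => -> //; rewrite mul0r.
Qed.

Lemma dot_column (R : realType) (m n k : nat) (M : 'M[R]_(m, n))
    (V : 'M[R]_(k, n)) (u : 'cV[R]_m) i :
  \sum_a (M *m V^T) a i * u a 0 = \sum_j coldot M u j * V i j.
Proof.
under eq_bigr do rewrite mxE mulr_suml.
rewrite exchange_big /=; apply: eq_bigr => j _.
by rewrite mulr_suml; apply: eq_bigr => a _; rewrite mxE mulrAC.
Qed.

Lemma fnorm_sqr_columns (R : realType) (p q : nat) (A : 'M[R]_(p, q)) :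
  fnorm A ^+ 2 = \sum_j \sum_i A i j ^+ 2.
Proof. by rewrite fnorm_sqr exchange_big. Qed.

Lemma unit_row (R : realType) (n k : nat) (V : 'M[R]_(k, n)) i :
  V *m V^T = 1%:M -> \sum_j V i j ^+ 2 = 1.
Proof.
move/matrixP => /(_ i i); rewrite !mxE eqxx mulr1n => <-.
by apply: eq_bigr => j _; rewrite mxE expr2.
Qed.

Lemma enorm_unit (R : realType) (p : nat) (x : 'cV[R]_p) :
  enorm x = 1 <-> \sum_i x i 0 ^+ 2 = 1.
Proof.
rewrite -enorm_sqr; split=> [->|]; first by rewrite expr1n.
by rewrite enorm_sqr /enorm => ->; rewrite sqrtr1.
Qed.

(** * Clusters from an orthogonal factor *)

(** Nonnegative orthonormal rows have disjoint supports; the zero columns of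
    [V] join the cluster [i0]. *)
Definition support_clusters (R : realType) (n k : nat) (i0 : 'I_k)
    (V : 'M[R]_(k, n)) (i : 'I_k) : {set 'I_n} :=
  [set j | ~~ (V i j <= 0) || (i == i0) && (\sum_l V l j <= 0)].

(** The columns of [M V^T] stand in for those of [U]: the two matrices are equal
    at an optimum, and the best [U] for a given [V] is [M V^T]. *)
Definition unit_columns (R : realType) (m n k : nat) (a0 : 'I_m)
    (M : 'M[R]_(m, n)) (V : 'M[R]_(k, n)) (i : 'I_k) : 'cV[R]_m :=
  \col_a normalize (fun b => (b == a0)%:R) (fun b => (M *m V^T) b i) a.

Lemma orthogonal_disjoint (R : realType) (n k : nat) (V : 'M[R]_(k, n)) :
  nonneg_mx V -> V *m V^T = 1%:M ->
  forall i l j, i != l -> ~~ (V i j <= 0) -> V l j <= 0.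
Proof.
move=> V_ge0 /matrixP V1 i l j il; rewrite -ltNge => Vij; rewrite leNgt.
apply/negP => Vlj; have /eqP := V1 i l; rewrite !mxE (negPf il) gt_eqF //.
rewrite (bigD1 j) //= mxE ltr_pwDl ?mulr_gt0 //.
by apply: sumr_ge0 => h _; rewrite mxE mulr_ge0.
Qed.

Lemma support_clusters_disjoint (R : realType) (n k : nat) (i0 : 'I_k)
    (V : 'M[R]_(k, n)) :
  nonneg_mx V -> V *m V^T = 1%:M -> disjoint_clusters (support_clusters i0 V).
Proof.
move=> V_ge0 V1; split=> [|i l il].
  apply/setP => j; rewrite in_setT; apply/bigcupP.
  have [/existsP[i Vij]|] := boolP [exists i, ~~ (V i j <= 0)].
    by exists i => //; rewrite inE Vij.
  rewrite negb_exists => /forallP V_le0; exists i0 => //.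
  by rewrite inE eqxx sumr_le0 ?orbT // => i _; have := V_le0 i; rewrite negbK.
have V_sum h j : ~~ (V h j <= 0) -> ~~ (\sum_l V l j <= 0).
  rewrite -!ltNge => Vhj; rewrite (bigD1 h) //= ltr_pwDl //.
  by apply: sumr_ge0 => ? _; apply: V_ge0.
apply/setP => j; rewrite !inE.
apply/negP => /andP[/orP[Vi|/andP[/eqP i_eq Vi]] /orP[Vl|/andP[/eqP l_eq Vl]]].
- by rewrite (orthogonal_disjoint V_ge0 V1 il Vi) in Vl.
- by have := V_sum _ _ Vi; rewrite Vl.
- by have := V_sum _ _ Vl; rewrite Vi.
- by rewrite i_eq l_eq eqxx in il.
Qed.

Lemma unit_columns_feasible (R : realType) (m n k : nat) (a0 : 'I_m)
    (M : 'M[R]_(m, n)) (V : 'M[R]_(k, n)) i :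
  nonneg_mx M -> nonneg_mx V ->
  nonneg_mx (unit_columns a0 M V i) /\ enorm (unit_columns a0 M V i) = 1.
Proof.
move=> M_ge0 V_ge0; split.
  move=> a b; rewrite mxE; apply: normalize_ge0 => {}b; first by case: eqP.
  by rewrite mxE; apply: sumr_ge0 => j _; rewrite mxE mulr_ge0.
apply/enorm_unit; under eq_bigr do rewrite mxE.
by apply: (@normalize_unit _ _ _ _ a0); rewrite eqxx oner_neq0.
Qed.

(** With [v] a row of [V] and [u = M v / ||M v||], Cauchy-Schwarz against [v]
    on its support gives
    [||M v||^2 = (u^T M v)^2 <= \sum_(j in supp v) (m_j^T u)^2]. *)
Lemma support_clusters_value (R : realType) (m n k : nat) (i0 : 'I_k)
    (a0 : 'I_m) (M : 'M[R]_(m, n)) (V : 'M[R]_(k, n)) :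
  nonneg_mx V -> V *m V^T = 1%:M ->
  fnorm (M *m V^T) ^+ 2 <=
  kmeans_objective M (support_clusters i0 V, unit_columns a0 M V).
Proof.
move=> V_ge0 V1; rewrite kmeans_objectiveE fnorm_sqr_columns.
apply: ler_sum => i _; set u := unit_columns a0 M V i.
rewrite -(sqr_dot_normalize (fun b => (b == a0)%:R)).
have -> : \sum_a (M *m V^T) a i *
    normalize (fun b => (b == a0)%:R) (fun b => (M *m V^T) b i) a =
    \sum_a (M *m V^T) a i * u a 0.
  by apply: eq_bigr => a _; rewrite [u a 0]mxE.
rewrite dot_column.
pose x j := if j \in support_clusters i0 V i then coldot M u j else 0.
have -> : \sum_j coldot M u j * V i j = \sum_j x j * V i j.
  apply: eq_bigr => j _; rewrite /x; case: ifP => // /negbT.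
  rewrite inE negb_or negbK => /andP[Vij _].
  by have -> : V i j = 0; [apply/eqP; rewrite eq_le Vij V_ge0 | rewrite !mulr0].
apply: le_trans (sqr_dot_unit_le _ (unit_row i V1)) _.
rewrite [leRHS]big_mkcond /=; apply: ler_sum => j _.
by rewrite /x; case: ifP; rewrite ?expr0n.
Qed.

(** * An orthogonal factor from clusters *)

(** An orthogonal factor needs every cluster to be nonempty; the second
    condition says that a column has either kept its cluster or become
    alone in its new one. *)
Definition refines (n k : nat) (C : {ffun 'I_k -> {set 'I_n}})
    (a : {ffun 'I_n -> 'I_k}) : bool :=
  [forall i, exists j, a j == i] &&
  [forall j, (j \in C (a j)) || [forall l, (a l == a j) ==> (l == j)]].

Definition refinement (n k : nat) (i0 : 'I_k) (C : {ffun 'I_k -> {set 'I_n}}) :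
    {ffun 'I_n -> 'I_k} :=
  odflt [ffun=> i0] [pick a | refines C a].

(** Among the assignments in which every column has kept its cluster or is
    alone, take one with the most nonempty clusters. Were a cluster empty,
    then two columns would share one, as [k <= n], and moving one of them to
    the empty cluster would give a better assignment. *)
Lemma surjective_reassignment (J I : finType) (p : J -> I) :
  (#|I| <= #|J|)%N ->
  exists a : {ffun J -> I}, (forall i, exists j, a j = i) /\
    forall j, a j = p j \/ forall l, a l = a j -> l = j.
Proof.
move=> leIJ.
pose Q (a : {ffun J -> I}) :=
  [forall j, (a j == p j) || [forall l, (a l == a j) ==> (l == j)]].
have QP (a : {ffun J -> I}) :
    reflect (forall j, a j = p j \/ forall l, a l = a j -> l = j) (Q a).
  apply: (iffP forallP) => Qa j.
    have /orP[/eqP|/forallP alone] := Qa j; [by left|right=> l al].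
    by have := alone l; rewrite al eqxx => /eqP.
  have [->|alone] := Qa j; first by rewrite eqxx.
  apply/orP; right; apply/forallP => l.
  by apply/implyP => /eqP /alone ->.
have Qp : Q [ffun j => p j] by apply/QP => j; left; rewrite ffunE.
case: (arg_maxnP (fun a : {ffun J -> I} => #|[set a j | j in J]|) Qp).
move=> a Qa a_max; exists a; split; last exact/QP.
move=> i; have [/imsetP[j _ ->]|iNa] := boolP (i \in [set a j | j in J]).
  by exists j.
have /injectivePn[j1 [j2 j12 a12]] : ~~ injectiveb a.
  apply: contra iNa => /injectiveP a_inj.
  have /eqP -> : [set a j | j in J] == setT; last by rewrite in_setT.
  by rewrite eqEcard subsetT cardsT card_imset.
pose b : {ffun J -> I} := [ffun j => if j == j1 then i else a j].
have aNi j : a j <> i by move=> aj; rewrite -aj imset_f in iNa.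
have Qb : Q b.
  apply/QP => j; rewrite ffunE; have [->|jj1] := eqVneq j j1.
    right=> l; rewrite ffunE; case: eqVneq => // _ /aNi //.
  have [apj|alone] := (QP _ Qa) j; [by left|right=> l].
  by rewrite ffunE; case: eqVneq => [_ /esym /aNi //|_ /alone].
have := a_max _ Qb; rewrite /= leqNgt; case/negP.
apply: proper_card; apply/properP; split; last first.
  by exists i => //; apply/imsetP; exists j1 => //; rewrite ffunE eqxx.
apply/subsetP => _ /imsetP[j _ ->]; apply/imsetP.
have [->|jj1] := eqVneq j j1; last by exists j => //; rewrite ffunE (negPf jj1).
by exists j2 => //; rewrite ffunE eq_sym (negPf j12).
Qed.

Lemma clusters_assignment (n k : nat) (pi : 'I_k -> {set 'I_n}) :
  disjoint_clusters pi ->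
  exists p : 'I_n -> 'I_k, forall i j, (j \in pi i) = (p j == i).
Proof.
move=> [cover_pi disj_pi].
have /choice[p p_in] : forall j, exists i, j \in pi i.
  move=> j; have : j \in [set: 'I_n] by [].
  by rewrite -cover_pi => /bigcupP[i _ ji]; exists i.
exists p => i j; have [<-|pji] := eqVneq; first exact: p_in.
have /setP /(_ j) := disj_pi _ _ pji.
by rewrite !inE p_in.
Qed.

Lemma refinementP (n k : nat) (i0 : 'I_k) (pi : 'I_k -> {set 'I_n})
    (p : 'I_n -> 'I_k) (a := refinement i0 (finfun pi)) :
  (k <= n)%N -> (forall i j, (j \in pi i) = (p j == i)) ->
  (forall i, exists j, a j = i) /\
  forall j, a j = p j \/ forall l, a l = a j -> l = j.
Proof.
move=> le_kn piE; rewrite {}/a /refinement; case: pickP => [a|none] /=.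
  move=> /andP[/forallP a_surj /forallP a_pi]; split=> [i|j].
    by have /existsP[j /eqP] := a_surj i; exists j.
  have /orP[|/forallP alone] := a_pi j.
    by rewrite ffunE piE => /eqP; left.
  by right=> l al; have := alone l; rewrite al eqxx => /eqP.
have [|a [a_surj a_p]] := @surjective_reassignment _ _ p.
  by rewrite !card_ord.
case/negP: (none a); apply/andP; split; apply/forallP.
  by move=> i; have [j /eqP] := a_surj i => ?; apply/existsP; exists j.
move=> j; rewrite ffunE piE; have [->|alone] := a_p j; first by rewrite eqxx.
by apply/orP; right; apply/forallP => l; apply/implyP => /eqP /alone ->.
Qed.

(** For given [u_i] the unit weights [v] on a cluster that maximize [u_i^T M v]
    are proportional to the inner products [m_j^T u_i]. The fallback, constant
    on the cluster, keeps the row a unit vector when all of these vanish. *)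
Definition cluster_factor (R : realType) (m n k : nat) (M : 'M[R]_(m, n))
    (u : 'I_k -> 'cV[R]_m) (a : 'I_n -> 'I_k) : 'M[R]_(k, n) :=
  \matrix_(i, j) normalize (fun l => (a l == i)%:R)
    (fun l => (a l == i)%:R * coldot M (u i) l) j.

Lemma cluster_factor_eq0 (R : realType) (m n k : nat) (M : 'M[R]_(m, n))
    (u : 'I_k -> 'cV[R]_m) (a : 'I_n -> 'I_k) i j :
  a j != i -> cluster_factor M u a i j = 0.
Proof. by move=> /negPf aji; rewrite mxE normalize_eq0 // aji ?mul0r. Qed.

Lemma cluster_factor_ge0 (R : realType) (m n k : nat) (M : 'M[R]_(m, n))
    (u : 'I_k -> 'cV[R]_m) (a : 'I_n -> 'I_k) :
  nonneg_mx M -> (forall i, nonneg_mx (u i)) ->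
  nonneg_mx (cluster_factor M u a).
Proof.
move=> M_ge0 u_ge0 i j; rewrite mxE; apply: normalize_ge0 => l.
  by case: eqP.
by rewrite mulr_ge0 ?coldot_ge0 //; case: eqP.
Qed.

Lemma cluster_factor_orthogonal (R : realType) (m n k : nat) (M : 'M[R]_(m, n))
    (u : 'I_k -> 'cV[R]_m) (a : 'I_n -> 'I_k) (V := cluster_factor M u a) :
  (forall i, exists j, a j = i) -> V *m V^T = 1%:M.
Proof.
move=> a_surj; apply/matrixP => i l; rewrite [LHS]mxE mxE.
under eq_bigr do rewrite [V^T _ _]mxE.
have [<-|il] := eqVneq i l.
  under eq_bigr do rewrite -expr2 mxE.
  have [j aj] := a_surj i.
  by apply: (@normalize_unit _ _ _ _ j); rewrite aj eqxx oner_neq0.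
apply: big1 => j _; have [aj|aj] := eqVneq (a j) i; last first.
  by rewrite [V i j]cluster_factor_eq0 ?mul0r.
by rewrite [V l j]cluster_factor_eq0 ?mulr0 // aj.
Qed.

(** Row [v] of the factor supported on a cluster [A] has
    [||M v||^2 >= (u^T M v)^2 = \sum_(j in A) (m_j^T u)^2] when [A] consists of
    columns that kept their cluster. When [A] is a single displaced column [j],
    [v] is the basis vector of [j] whatever [u] is, and [||M v||^2 = ||m_j||^2]
    is at least what [j] contributed before. *)
Lemma cluster_factor_value (R : realType) (m n k : nat) (M : 'M[R]_(m, n))
    (u : 'I_k -> 'cV[R]_m) (a p : 'I_n -> 'I_k) (V := cluster_factor M u a) :
  (forall i, enorm (u i) = 1) -> (forall i, exists j, a j = i) ->
  (forall j, a j = p j \/ forall l, a l = a j -> l = j) ->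
  \sum_j coldot M (u (p j)) j ^+ 2 <= fnorm (M *m V^T) ^+ 2.
Proof.
move=> u1 a_surj a_p.
have V1 : V *m V^T = 1%:M by exact: cluster_factor_orthogonal.
rewrite fnorm_sqr_columns (partition_big a predT) //=; apply: ler_sum => i _.
(* Either the cluster holds a displaced column [j], or all have kept theirs. *)
have [/existsP[j /andP[/eqP aj apj]]|] :=
  boolP [exists j, (a j == i) && (a j != p j)]; last first.
  rewrite negb_exists => /forallP kept.
  have /enorm_unit ui := u1 i.
  apply: le_trans (sqr_dot_unit_le _ ui); rewrite dot_column.
  pose x l := (a l == i)%:R * coldot M (u i) l.
  have -> : \sum_j coldot M (u i) j * V i j =
      \sum_j x j * normalize (fun l => (a l == i)%:R) x j.
    apply: eq_bigr => j _; rewrite mxE -/x {2}/x.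
    case: eqVneq => [_|aj]; first by rewrite mul1r.
    by rewrite normalize_eq0 /x ?(negPf aj) ?mul0r ?mulr0.
  rewrite sqr_dot_normalize big_mkcond /=; apply: ler_sum => j _.
  have := kept j; rewrite /x; case: eqP => [<-|]; last by rewrite mul0r expr0n.
  by rewrite negbK mul1r => /eqP <-.
have {a_p} alone : forall l, a l = i -> l = j.
  by rewrite -aj; have [/eqP|//] := a_p j; rewrite (negPf apj).
have V0 l : l != j -> V i l = 0.
  by move=> lj; apply: cluster_factor_eq0; apply: contra lj => /eqP /alone ->.
have Vij : V i j ^+ 2 = 1.
  rewrite -[RHS](unit_row i V1) (bigD1 j) //= big1 ?addr0 // => l /V0 ->.
  by rewrite expr0n.
rewrite (bigD1 j) ?aj //= big1 ?addr0 => [|l /andP[/eqP /alone ->]]; last first.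
  by rewrite eqxx.
have /enorm_unit up := u1 (p j).
apply: le_trans (sqr_dot_unit_le _ up) _; apply: ler_sum => b _.
rewrite mxE (bigD1 j) //= big1 ?addr0 => [|l /V0 Vil]; last first.
  by rewrite [V^T _ _]mxE Vil mulr0.
by rewrite [V^T _ _]mxE exprMn Vij mulr1.
Qed.

(** * Equivalence *)

Definition onmf_to_kmeans (R : realType) (m n k : nat) (i0 : 'I_k) (a0 : 'I_m)
    (z : 'M[R]_(m, n) * onmf_point R m n k) : kmeans_point R m n k :=
  (support_clusters i0 z.2.2, unit_columns a0 z.1 z.2.2).

Definition kmeans_factor (R : realType) (m n k : nat) (i0 : 'I_k)
    (z : 'M[R]_(m, n) * kmeans_point R m n k) : 'M[R]_(k, n) :=
  cluster_factor z.1 z.2.2 (refinement i0 (finfun z.2.1)).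

Definition kmeans_to_onmf (R : realType) (m n k : nat) (i0 : 'I_k)
    (z : 'M[R]_(m, n) * kmeans_point R m n k) : onmf_point R m n k :=
  (z.1 *m (kmeans_factor i0 z)^T, kmeans_factor i0 z).

Lemma onmf_to_kmeansP (R : realType) (m n k : nat) (i0 : 'I_k) (a0 : 'I_m)
    (M : 'M[R]_(m, n)) (x : onmf_point R m n k)
    (y := onmf_to_kmeans i0 a0 (M, x)) :
  nonneg_mx M -> onmf_feasible x ->
  kmeans_feasible y /\
  fnorm M ^+ 2 - onmf_objective M x <= kmeans_objective M y.
Proof.
case: x @y => U V y M_ge0 [U_ge0 V_ge0 V1]; split.
  split=> [|i]; first exact: support_clusters_disjoint.
  exact: unit_columns_feasible.
apply: le_trans (support_clusters_value i0 a0 M V_ge0 V1).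
by rewrite /= onmf_residual //; have := sqr_ge0 (fnorm (U - M *m V^T)); lra.
Qed.

Lemma kmeans_to_onmfP (R : realType) (m n k : nat) (i0 : 'I_k)
    (M : 'M[R]_(m, n)) (y : kmeans_point R m n k)
    (x := kmeans_to_onmf i0 (M, y)) :
  (k <= n)%N -> nonneg_mx M -> kmeans_feasible y ->
  onmf_feasible x /\
  kmeans_objective M y <= fnorm M ^+ 2 - onmf_objective M x.
Proof.
case: y @x => pi u x le_kn M_ge0 [pi_part u_feas].
have [p piE] := clusters_assignment pi_part.
have [a_surj a_p] := refinementP i0 le_kn piE.
have V1 := cluster_factor_orthogonal M u a_surj.
have V_ge0 : nonneg_mx (kmeans_factor i0 (M, (pi, u))).
  by apply: cluster_factor_ge0 => // i; have [] := u_feas i.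
split.
  split=> // b i; rewrite mxE; apply: sumr_ge0 => j _.
  by rewrite mulr_ge0 // mxE.
rewrite /= onmf_residual // subrr [fnorm 0 ^+ 2]fnorm_sqr.
rewrite [\sum_i \sum_j (0 : 'M_(_, _)) i j ^+ 2]big1 => [|i _]; last first.
  by apply: big1 => j _; rewrite mxE expr0n.
rewrite addr0 subKr [leLHS]kmeans_objectiveE.
apply: le_trans (cluster_factor_value M _ a_surj a_p) => [|i]; last first.
  by have [] := u_feas i.
rewrite [leRHS](partition_big p predT) //=; apply: ler_sum => i _.
rewrite (eq_bigl (fun j => p j == i)) => [|j]; last exact: piE.
by apply: ler_sum => j /eqP ->.
Qed.

Lemma onmf_to_kmeans_arith (R : realType) (m n k : nat) (i0 : 'I_k)
    (a0 : 'I_m) :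
  arith_map (with_data (@onmf_coord R m n k)) (@kmeans_coord R m n k)
    (onmf_to_kmeans i0 a0).
Proof.
pose c := @with_data R m n _ _ (@onmf_coord R m n k).
have cM a j : arith c (fun z => z.1 a j) by exact: (arith_input c (inl (a, j))).
have cV i j : arith c (fun z => z.2.2 i j).
  exact: (arith_input c (inr (inr (i, j)))).
case=> [[i j]|[i a]].
  apply: (@arith_ext _ _ _ c (fun z => if z.2.2 i j <= 0%:R then
      if \sum_l z.2.2 l j <= 0%:R then (i == i0)%:R else 0%:R else 1%:R)).
    move=> z /=; rewrite inE; case: ifP => //= _.
    by case: ifP; rewrite ?andbT ?andbF.
  apply: arith_test; [exact: cV|exact: arith_nat| |exact: arith_nat].
  by apply: arith_test; [exact: arith_sum|exact: arith_nat..].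
apply: arith_ext => [z|]; first by rewrite /= mxE.
apply: (arith_normalize (d := fun b _ => _) (x := fun b z => _)) => b.
  exact: arith_nat.
apply: arith_ext => [z|]; first by rewrite mxE.
apply: arith_sum => j; apply: arith_ext (arith_mul (cM b j) (cV i j)) => z.
by rewrite mxE.
Qed.

Lemma kmeans_to_onmf_arith (R : realType) (m n k : nat) (i0 : 'I_k) :
  arith_map (with_data (@kmeans_coord R m n k)) (@onmf_coord R m n k)
    (kmeans_to_onmf i0).
Proof.
pose c := @with_data R m n _ _ (@kmeans_coord R m n k).
have cM a j : arith c (fun z => z.1 a j) by exact: (arith_input c (inl (a, j))).
have cpi i j : arith c (fun z => (j \in z.2.1 i)%:R).
  exact: (arith_input c (inr (inl (i, j)))).
have cu i a : arith c (fun z => z.2.2 i a 0).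
  exact: (arith_input c (inr (inr (i, a)))).
have cC (C : {ffun 'I_k -> {set 'I_n}}) :
    arith c (fun z => (finfun z.2.1 == C)%:R).
  apply: (@arith_ext _ _ _ c (fun z => \prod_i \prod_j
      if j \in C i then (j \in z.2.1 i)%:R else 1%:R - (j \in z.2.1 i)%:R)).
    move=> z; case: eqP => [<-|/eqP C_neq].
      apply: big1 => i _; apply: big1 => j _; rewrite ffunE.
      by case: (j \in z.2.1 i); rewrite /= ?subr0.
    have /existsP[i /existsP[j Cij]] :
        [exists i, exists j, (j \in C i) != (j \in z.2.1 i)].
      apply: contraR C_neq; rewrite negb_exists => /forallP Cz.
      apply/eqP/ffunP => i; rewrite ffunE; apply/setP => j.
      have := Cz i; rewrite negb_exists => /forallP /(_ j).
      by rewrite negbK => /eqP.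
    rewrite (bigD1 i) //= (bigD1 j) //= [X in X * _ * _ = _](_ : _ = 0).
      by rewrite !mul0r.
    by case: (j \in C i) Cij; case: (j \in _); rewrite //= ?subrr.
  apply: arith_prod => i; apply: arith_prod => j; case: (j \in C i) => //.
  by apply: arith_add; [exact: arith_nat|exact: arith_opp].
have cV i j : arith c (fun z => kmeans_factor i0 z i j).
  pose F (C : {ffun 'I_k -> {set 'I_n}})
      (z : 'M[R]_(m, n) * kmeans_point R m n k) :=
    normalize (fun l => (refinement i0 C l == i)%:R)
      (fun l => (refinement i0 C l == i)%:R * coldot z.1 (z.2.2 i) l) j.
  apply: (@arith_ext _ _ _ c (fun z => F (finfun z.2.1) z)).
    by move=> z; rewrite mxE.
  apply: arith_case => // C.
  apply: (arith_normalize (d := fun l _ => _) (x := fun l z => _)) => l.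
    exact: arith_nat.
  apply: arith_mul; first exact: arith_nat.
  by apply: arith_sum => a; apply: arith_mul.
case=> [[a i]|[i j]]; last exact: cV.
apply: arith_ext => [z|]; first by rewrite /= mxE.
apply: arith_sum => j; apply: arith_ext (arith_mul (cM a j) (cV i j)) => z.
by rewrite [_^T _ _]mxE.
Qed.

Theorem theorem2p1 (R : realType) (m n k : nat)
    (hm : (0 < m)%N) (hk : (0 < k)%N) (hkn : (k < n)%N) :
  (exists phi : 'M[R]_(m, n) * onmf_point R m n k -> kmeans_point R m n k,
     arith_map (with_data (@onmf_coord R m n k)) (@kmeans_coord R m n k) phi /\
     forall M : 'M[R]_(m, n), nonneg_mx M ->
     forall x, onmf_solution M x -> kmeans_solution M (phi (M, x))) /\
  (exists psi : 'M[R]_(m, n) * kmeans_point R m n k -> onmf_point R m n k,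
     arith_map (with_data (@kmeans_coord R m n k)) (@onmf_coord R m n k) psi /\
     forall M : 'M[R]_(m, n), nonneg_mx M ->
     forall y, kmeans_solution M y -> onmf_solution M (psi (M, y))).
Proof.
pose i0 := Ordinal hk; pose a0 := Ordinal hm; have le_kn := ltnW hkn.
split; [exists (onmf_to_kmeans i0 a0) | exists (kmeans_to_onmf i0)].
  split=> [|M M_ge0 x [x_feas x_min]]; first exact: onmf_to_kmeans_arith.
  have [phi_feas x_phi] := onmf_to_kmeansP i0 a0 M_ge0 x_feas.
  split=> // y y_feas.
  have [psi_feas y_psi] := kmeans_to_onmfP i0 le_kn M_ge0 y_feas.
  by have := x_min _ psi_feas; lra.
split=> [|M M_ge0 y [y_feas y_max]]; first exact: kmeans_to_onmf_arith.
have [psi_feas y_psi] := kmeans_to_onmfP i0 le_kn M_ge0 y_feas.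
split=> // x x_feas.
have [phi_feas x_phi] := onmf_to_kmeansP i0 a0 M_ge0 x_feas.
by have := y_max _ phi_feas; lra.
Qed.
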